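(* Let $\Lambda$ be a left and right Noetherian ring which is 2-Gorenstein and let $A$ be a finitely generated torsionless left $\Lambda$-module. Then the following statements are equivalent. (1) $A$ is reflexive. (2) $C$ has no non-zero pseudo-null submodule for any $C\in\mathcal E_A$. (3) $C$ has no non-zero pseudo-null submodule for some $C\in\mathcal E_A$.
   Context: Let $0\to{}_\Lambda\Lambda\to I'_0\to I'_1\to\cdots$ be a minimal injective resolution of $\Lambda$ as a left module. $\Lambda$ is 2-Gorenstein if $I'_0$ is flat and $I'_1$ has flat dimension at most $1$. Write $(\ )^*=\mathrm{Hom}(\ ,\Lambda)$ and let $\sigma_A:A\to A^{**}$ be the canonical evaluation map. $A$ is torsionless if $\sigma_A$ is a monomorphism, and reflexive if $\sigma_A$ is an isomorphism. For a finitely generated torsionless left module $A$, $\mathcal E_A$ is the class of non-zero finitely generated left modules $C$ for which there is an exact sequence $0\to A\to G\to C\to0$ with $G$ a finitely generated free left module. A finitely generated left module $M$ is pseudo-null if $\mathrm{Hom}_\Lambda(M,I'_0\oplus I'_1)=0$. *)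

(* Defs.v *)
From HB Require Import structures.
From mathcomp Require Import all_boot all_order all_algebra.
From mathcomp Require Import freeg.
From mathcomp Require Import boolp.

Set Implicit Arguments.
Unset Strict Implicit.
Unset Printing Implicit Defensive.

Import GRing.Theory.
Local Open Scope ring_scope.

(* Left modules over a ring [R] are [lmodType R]; right modules are
   [lmodType R^c], the right action [n . r] being written [r *: n]. *)

Section Modules.
Variable R : nzRingType.

Definition submodule (M : lmodType R) (S : M -> Prop) : Prop :=
  S 0 /\ forall (a : R) (x y : M), S x -> S y -> S (a *: x + y).

Definition finitely_generated (M : lmodType R) : Prop :=
  exists (n : nat) (e : 'I_n -> M),
    forall x : M, exists c : 'I_n -> R, x = \sum_(i < n) c i *: e i.

Definition fg_free (G : lmodType R) : Prop :=
  exists (n : nat) (e : 'I_n -> G),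
    forall x : G, exists! c : {ffun 'I_n -> R}, x = \sum_(i < n) c i *: e i.

Definition nonzero (M : lmodType R) : Prop := exists x : M, x != 0.

Definition exact_at (L M N : lmodType R)
    (f : {linear L -> M}) (g : {linear M -> N}) : Prop :=
  forall y : M, g y = 0 <-> exists x : L, f x = y.

Definition short_exact (L M N : lmodType R)
    (f : {linear L -> M}) (g : {linear M -> N}) : Prop :=
  [/\ injective f, exact_at f g & forall z : N, exists y : M, g y = z].

Definition left_noetherian : Prop :=
  forall J : nat -> R^o -> Prop,
    (forall k, submodule (J k)) ->
    (forall k x, J k x -> J k.+1 x) ->
    exists m, forall k, (m <= k)%N -> forall x, J k x <-> J m x.

Definition injective_module (E : lmodType R) : Prop :=
  forall (M N : lmodType R) (i : {linear M -> N}) (f : {linear M -> E}),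
    injective i -> exists g : {linear N -> E}, forall x, g (i x) = f x.

Definition essential_image (X E : lmodType R) (f : {linear X -> E}) : Prop :=
  forall S : E -> Prop, submodule S -> (exists y, S y /\ y != 0) ->
    exists x : X, S (f x) /\ f x != 0.

(* Minimality: each [I n] is an injective envelope of the image of the map
   entering it, i.e. of the preceding cosyzygy. *)
Definition minimal_injective_resolution (M : lmodType R)
    (I : nat -> lmodType R) (eta : {linear M -> I 0%N})
    (d : forall n, {linear I n -> I n.+1}) : Prop :=
  [/\ injective eta,
      exact_at eta (d 0%N) /\ (forall n, exact_at (d n) (d n.+1)),
      forall n, injective_module (I n)
    & essential_image eta /\ forall n, essential_image (d n)].

End Modules.

Definition right_noetherian (R : nzRingType) : Prop := left_noetherian R^c.

Section Tensor.
Variables (R : nzRingType) (N : lmodType R^c) (M : lmodType R).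

(* The subgroup of the free abelian group on [N * M] whose quotient is
   the tensor product of [N] and [M] over [R]. *)
Inductive tensor_relation : {freeg (N * M)%type} -> Prop :=
| tensor_rel0 : tensor_relation 0
| tensor_relB x y :
    tensor_relation x -> tensor_relation y -> tensor_relation (x - y)
| tensor_relDl n n' m :
    tensor_relation (<< (n + n', m) >> - << (n, m) >> - << (n', m) >>)
| tensor_relDr n m m' :
    tensor_relation (<< (n, m + m') >> - << (n, m) >> - << (n, m') >>)
| tensor_relM n r m :
    tensor_relation (<< ((r : R^c) *: n, m) >> - << (n, (r : R) *: m) >>).

Definition tensor_pred : {pred {freeg (N * M)%type}} :=
  fun x => `[< tensor_relation x >].

Lemma tensor_pred_zmod : zmod_closed tensor_pred.
Proof.
split; first by apply/asboolP; exact: tensor_rel0.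
by move=> x y /asboolP hx /asboolP hy; apply/asboolP; exact: tensor_relB.
Qed.

HB.instance Definition _ :=
  GRing.isZmodClosed.Build _ tensor_pred tensor_pred_zmod.

Definition tensor_quot := Quotient.quot tensor_pred.
Definition tensor : zmodType := tensor_quot.

Definition tens (n : N) (m : M) : tensor :=
  \pi_tensor_quot%qT << (n, m) >>.

End Tensor.
Arguments tens {R N M}.

Section TensorTheory.
Variables (R : nzRingType) (N : lmodType R^c) (M : lmodType R).

Lemma tensor_eq0 (x : {freeg (N * M)%type}) :
  tensor_relation x <-> \pi_(tensor_quot N M)%qT x = 0.
Proof.
have E : (x \in @tensor_pred R N M) =
    (x == 0 %[mod tensor_quot N M])%qT.
  by rewrite -Quotient.idealrBE subr0.
have Z : \pi_(tensor_quot N M)%qT 0 = 0 by rewrite raddf0.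
by split=> [/asboolP h|h]; [apply/eqP; rewrite -[X in _ == X]Z -E
  |apply/asboolP; rewrite -[X in is_true X]/(x \in @tensor_pred R N M) E h Z].
Qed.

Lemma tensDl (n n' : N) (m : M) : tens (n + n') m = tens n m + tens n' m.
Proof.
have /tensor_eq0 := tensor_relDl n n' m.
by rewrite !raddfB /= => /eqP; rewrite -addrA -opprD subr_eq0 => /eqP.
Qed.

Lemma tensDr (n : N) (m m' : M) : tens n (m + m') = tens n m + tens n m'.
Proof.
have /tensor_eq0 := tensor_relDr n m m'.
by rewrite !raddfB /= => /eqP; rewrite -addrA -opprD subr_eq0 => /eqP.
Qed.

Lemma tensM (n : N) (r : R) (m : M) :
  tens ((r : R^c) *: n) m = tens n (r *: m).
Proof.
by have /tensor_eq0 := tensor_relM n r m; rewrite raddfB => /eqP;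
   rewrite subr_eq0 => /eqP.
Qed.

Definition balanced (V : zmodType) (b : N -> M -> V) : Prop :=
  [/\ forall n n' m, b (n + n') m = b n m + b n' m,
      forall n m m', b n (m + m') = b n m + b n m'
    & forall n (r : R) m, b ((r : R^c) *: n) m = b n (r *: m)].

(* The additive map induced by [b], meaningful when [b] is balanced. *)
Definition tensor_lift (V : zmodType) (b : N -> M -> V) (t : tensor N M) : V :=
  fglift (fun k : (N * M)%type => b k.1 k.2 : zmodule V)
    (@repr _ (tensor_quot N M) t).

Section Lift.
Variables (V : zmodType) (b : N -> M -> V).
Hypothesis hb : balanced b.
Let L := fglift (fun k : (N * M)%type => b k.1 k.2 : zmodule V).

Let LB : {morph L : x y / x - y}.
Proof. exact: lift_is_additive. Qed.

Let LU k : L << k >> = b k.1 k.2.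
Proof. by rewrite /L liftU scale1r. Qed.

Let L_rel x : tensor_relation x -> L x = 0.
Proof.
case: hb => bDl bDr bM.
elim=> [|{}x y _ hx _ hy|n n' m|n m m'|n r m].
- by rewrite -[0]subr0 LB subrr.
- by rewrite LB hx hy subrr.
- by rewrite !LB !LU /= bDl addrAC addrK subrr.
- by rewrite !LB !LU /= bDr addrAC addrK subrr.
- by rewrite LB !LU /= bM subrr.
Qed.

Let lift_pi x : tensor_lift b (\pi_(tensor_quot N M)%qT x) = L x.
Proof.
rewrite /tensor_lift -/L; apply/eqP; rewrite -subr_eq0 -LB; apply/eqP.
by apply: L_rel; apply/tensor_eq0; rewrite raddfB /= reprK subrr.
Qed.

Lemma tensor_lift_tens n m : tensor_lift b (tens n m) = b n m.
Proof. by rewrite lift_pi LU. Qed.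

Lemma tensor_lift_additive : {morph tensor_lift b : s t / s - t}.
Proof.
move=> s t; rewrite -[s](@reprK _ (tensor_quot N M)).
rewrite -[t](@reprK _ (tensor_quot N M)) -raddfB !lift_pi.
exact: LB.
Qed.

End Lift.
End TensorTheory.

(* The map [f (x) M]. *)
Definition tensor_map (R : nzRingType) (N N' : lmodType R^c) (M : lmodType R)
    (f : {linear N -> N'}) : tensor N M -> tensor N' M :=
  tensor_lift (fun n m => tens (f n) m).

Lemma tensor_map_balanced (R : nzRingType) (N N' : lmodType R^c)
    (M : lmodType R) (f : {linear N -> N'}) :
  balanced (fun (n : N) (m : M) => tens (f n) m).
Proof.
by split=> [n n' m|n m m'|n r m]; rewrite ?raddfD ?tensDl ?tensDr ?linearZ ?tensM.
Qed.

Lemma tensor_map_tens (R : nzRingType) (N N' : lmodType R^c)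
    (M : lmodType R) (f : {linear N -> N'}) n (m : M) :
  tensor_map f (tens n m) = tens (f n) m.
Proof. exact: tensor_lift_tens (tensor_map_balanced M f) n m. Qed.

Definition flat (R : nzRingType) (M : lmodType R) : Prop :=
  forall (N N' : lmodType R^c) (f : {linear N -> N'}),
    injective f -> injective (tensor_map (M := M) f).

Definition flat_dim_le1 (R : nzRingType) (M : lmodType R) : Prop :=
  exists (F1 F0 : lmodType R) (u : {linear F1 -> F0}) (v : {linear F0 -> M}),
    [/\ flat F1, flat F0 & short_exact u v].

(* The abelian group Hom(U, V). *)
Definition hom (R : nzRingType) (U V : lmodType R) : Type := {linear U -> V}.

Section Hom.
Variables (R : nzRingType) (U V : lmodType R).

Definition hom_fun (f : hom U V) : {linear U -> V} := f.
Coercion hom_fun : hom >-> GRing.Linear.type.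

HB.instance Definition _ := gen_eqMixin (hom U V).
HB.instance Definition _ := gen_choiceMixin (hom U V).

Lemma homP (f g : hom U V) : hom_fun f =1 hom_fun g -> f = g.
Proof.
case: f g => [f [[hf0] [hf]]] [g [[hg0] [hg]]] /= e.
have {}e : f = g by apply/funext.
subst g.
by rewrite (Prop_irrelevance hf0 hg0) (Prop_irrelevance hf hg).
Qed.

Definition hom0 : hom U V := (\0 : {linear U -> V}).
Definition homD (f g : hom U V) : hom U V :=
  (hom_fun f \+ hom_fun g : {linear U -> V}).
Definition homN (f : hom U V) : hom U V := (\- hom_fun f : {linear U -> V}).

Lemma homDA : associative homD.
Proof. by move=> f g h; apply: homP => x; rewrite /= addrA. Qed.
Lemma homDC : commutative homD.
Proof. by move=> f g; apply: homP => x; rewrite /= addrC. Qed.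
Lemma hom0D : left_id hom0 homD.
Proof. by move=> f; apply: homP => x; rewrite /= add0r. Qed.
Lemma homND : left_inverse hom0 homN homD.
Proof. by move=> f; apply: homP => x; rewrite /= addNr. Qed.

HB.instance Definition _ := GRing.isZmodule.Build (hom U V) homDA homDC hom0D homND.

End Hom.

Section LeftDual.
Variables (R : nzRingType) (A : lmodType R).

(* The right module Hom(A, R), with (f . r) x = f x * r. *)
Definition dual : Type := hom A R^o.
HB.instance Definition _ := GRing.Zmodule.on dual.

Section Scale.
Variables (r : R) (f : dual).
Definition dual_scale_fun (x : A) : R^o := f x * r.
Lemma dual_scale_linear : linear dual_scale_fun.
Proof.
by move=> a x y; rewrite /dual_scale_fun linearP mulrDl /GRing.scale /= mulrA.
Qed.
HB.instance Definition _ :=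
  GRing.isLinear.Build R A R^o *:%R dual_scale_fun dual_scale_linear.
Definition dual_scale : dual := (dual_scale_fun : {linear A -> R^o}).
End Scale.

Lemma dual_scaleA (r s : R^c) (f : dual) :
  dual_scale r (dual_scale s f) = dual_scale (r * s) f.
Proof. by apply: homP => x; rewrite /= /dual_scale_fun /= -mulrA. Qed.
Lemma dual_scale1 : left_id (1 : R^c) dual_scale.
Proof. by move=> f; apply: homP => x; rewrite /= /dual_scale_fun mulr1. Qed.
Lemma dual_scaleDr : right_distributive (dual_scale : R^c -> dual -> dual) +%R.
Proof. by move=> r f g; apply: homP => x; rewrite /= /dual_scale_fun mulrDl. Qed.
Lemma dual_scaleDl (f : dual) : {morph (dual_scale : R^c -> dual -> dual)^~ f : r s / r + s}.
Proof. by move=> r s; apply: homP => x; rewrite /= /dual_scale_fun mulrDr. Qed.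

HB.instance Definition _ := GRing.Zmodule_isLmodule.Build R^c dual
  dual_scaleA dual_scale1 dual_scaleDr dual_scaleDl.

End LeftDual.

Section RightDual.
Variables (R : nzRingType) (N : lmodType R^c).

(* The left module Hom(N, R) of a right module N, with (a . g) n = a * g n. *)
Definition rdual : Type := hom N (R^c)^o.
HB.instance Definition _ := GRing.Zmodule.on rdual.

Section Scale.
Variables (a : R) (g : rdual).
Definition rdual_scale_fun (n : N) : (R^c)^o := (a : R) * (g n : R).
Lemma rdual_scale_linear : linear rdual_scale_fun.
Proof.
by move=> r x y; rewrite /rdual_scale_fun linearP mulrDr /GRing.scale /= mulrA.
Qed.
HB.instance Definition _ :=
  GRing.isLinear.Build R^c N (R^c)^o *:%R rdual_scale_fun rdual_scale_linear.
Definition rdual_scale : rdual := (rdual_scale_fun : {linear N -> (R^c)^o}).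
End Scale.

Lemma rdual_scaleA (a b : R) (g : rdual) :
  rdual_scale a (rdual_scale b g) = rdual_scale (a * b) g.
Proof. by apply: homP => x; rewrite /= /rdual_scale_fun /= mulrA. Qed.
Lemma rdual_scale1 : left_id (1 : R) rdual_scale.
Proof. by move=> g; apply: homP => x; rewrite /= /rdual_scale_fun mul1r. Qed.
Lemma rdual_scaleDr : right_distributive rdual_scale +%R.
Proof. by move=> a g h; apply: homP => x; rewrite /= /rdual_scale_fun mulrDr. Qed.
Lemma rdual_scaleDl (g : rdual) : {morph rdual_scale^~ g : a b / a + b}.
Proof. by move=> a b; apply: homP => x; rewrite /= /rdual_scale_fun mulrDl. Qed.

HB.instance Definition _ := GRing.Zmodule_isLmodule.Build R rdual
  rdual_scaleA rdual_scale1 rdual_scaleDr rdual_scaleDl.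

End RightDual.

Section Evaluation.
Variables (R : nzRingType) (A : lmodType R).

Section At.
Variable x : A.
Definition eval_fun (f : dual A) : (R^c)^o := hom_fun f x.
Lemma eval_fun_linear : linear eval_fun.
Proof. by []. Qed.
HB.instance Definition _ :=
  GRing.isLinear.Build R^c (dual A) (R^c)^o *:%R eval_fun eval_fun_linear.
End At.

Definition sigma (x : A) : rdual (dual A) :=
  (eval_fun x : {linear dual A -> (R^c)^o}).
Lemma sigma_linear : linear sigma.
Proof. by move=> a x y; apply: homP => f; rewrite /= /eval_fun linearP. Qed.
HB.instance Definition _ :=
  GRing.isLinear.Build R A (rdual (dual A)) *:%R sigma sigma_linear.

End Evaluation.

Definition torsionless (R : nzRingType) (A : lmodType R) : Prop :=
  injective (@sigma R A).

Definition reflexive_module (R : nzRingType) (A : lmodType R) : Prop :=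
  bijective (@sigma R A).

Section PseudoNull.
Variable R : nzRingType.

Definition E_class (A C : lmodType R) : Prop :=
  [/\ nonzero C, finitely_generated C &
      exists (G : lmodType R) (u : {linear A -> G}) (v : {linear G -> C}),
        fg_free G /\ short_exact u v].

(* In the remaining definitions [I] is meant to be a minimal injective
   resolution of the left module [R]; such a resolution is unique up to
   isomorphism. *)
Definition two_gorenstein (I : nat -> lmodType R) : Prop :=
  flat (I 0%N) /\ flat_dim_le1 (I 1%N).

Definition pseudo_null (I : nat -> lmodType R) (M : lmodType R) : Prop :=
  finitely_generated M /\
  forall f : hom M (I 0%N * I 1%N)%type, f = 0.

(* A submodule of [C] is given by an injective linear map into [C]. *)
Definition no_pseudo_null_submodule (I : nat -> lmodType R) (C : lmodType R)
  : Prop :=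
  forall (M : lmodType R) (i : {linear M -> C}),
    injective i -> pseudo_null I M -> ~ nonzero M.

End PseudoNull.

(* Main.v *)
(* If [A] is reflexive and [M] is a pseudo-null submodule of [C = G / A], let [B]
   be the preimage of [M] in [G]. Since [Hom(M, I 0) = Hom(M, I 1) = 0], every map
   [A -> R] extends uniquely to [B], so a point of [B] evaluates on [A^*], hence
   is a point of [A]: maps to [R] separate the points of [G].

   Conversely, flatness of [I 0] makes [A^** -> G^** = G] injective, so [A^** / A]
   is a submodule of [C]. It is pseudo-null: as [A^**] embeds in a finite free
   module, a map [A^** -> E] into an injective module is [phi |-> sum phi(f_i) y_i].
   If it kills [A], then [sum f_i (x) y_i] vanishes in [Hom(A, E)], and for [E] of
   flat dimension at most 1 this forces [sum phi(f_i) y_i = 0] for all [phi]. All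
   uses of flatness go through the equational criterion. *)

Require Import Defs.
From HB Require Import structures.
From mathcomp Require Import all_boot all_order all_algebra.
From mathcomp Require Import boolp.

Set Implicit Arguments.
Unset Strict Implicit.
Unset Printing Implicit Defensive.

Import GRing.Theory.
Local Open Scope ring_scope.

(** * Factoring and lifting linear maps *)

Section LinearMaps.
Variable R : nzRingType.

Definition linear_of (U V : lmodType R) (f : U -> V) (hf : linear f) :
    {linear U -> V} :=
  HB.pack_for {linear U -> V} f (GRing.isLinear.Build R U V *:%R f hf).

(** A chosen preimage under [q] need not depend linearly on [m], but [h] takes the same value on all
    preimages, so the composite is linear. *)
Lemma linear_factor (X Y M Z : lmodType R) (q : {linear X -> Y})
    (i : {linear M -> Y}) (h : {linear X -> Z}) :
  (forall m, exists x, q x = i m) -> (forall x, q x = 0 -> h x = 0) ->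
  exists k : {linear M -> Z}, forall x m, q x = i m -> k m = h x.
Proof.
move=> /choice[s qs] hker.
have inv x y : q x = q y -> h x = h y.
  move=> e; apply/eqP; rewrite -subr_eq0 -raddfB; apply/eqP/hker.
  by rewrite linearB e subrr.
have lin : linear (fun m => h (s m)).
  by move=> a m n; rewrite -linearP; apply: inv; rewrite linearP !qs linearP.
by exists (linear_of lin) => x m e /=; apply: inv; rewrite qs.
Qed.

Lemma linear_lift (U V W : lmodType R) (j : {linear U -> V})
    (h : {linear W -> V}) :
  injective j -> (forall x, exists y, j y = h x) ->
  exists k : {linear W -> U}, forall x, j (k x) = h x.
Proof.
move=> jI /choice[s js].
have lin : linear s by move=> a x y; apply: jI; rewrite linearP !js linearP.
by exists (linear_of lin).
Qed.

Lemma ker_submodule (U V : lmodType R) (f : {linear U -> V}) :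
  submodule (fun x => f x = 0).
Proof.
by split=> [|a x y hx hy]; rewrite ?raddf0 // linearP hx hy scaler0 addr0.
Qed.

Lemma range_submodule (U V : lmodType R) (f : {linear U -> V}) :
  submodule (fun y => exists x, f x = y).
Proof.
split=> [|a _ _ [x <-] [y <-]]; first by exists 0; rewrite raddf0.
by exists (a *: x + y); rewrite linearP.
Qed.

Lemma preim_submodule (U V : lmodType R) (f : {linear U -> V}) (S : V -> Prop) :
  submodule S -> submodule (fun x => S (f x)).
Proof.
by case=> S0 SP; split=> [|a x y hx hy]; rewrite ?raddf0 // linearP; apply: SP.
Qed.

End LinearMaps.

(** * Submodules as modules, and quotients *)

Section Submodules.
Variable R : nzRingType.

(** Indexing the predicate by [hS] lets instance inference find its closure properties. *)
Definition submodule_pred (M : lmodType R) (S : M -> Prop) (hS : submodule S) :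
  {pred M} := fun x => `[< S x >].

Lemma submodule_pred_closed (M : lmodType R) (S : M -> Prop)
  (hS : submodule S) : GRing.submod_closed (submodule_pred hS).
Proof.
case: (hS) => S0 SP; split; first exact/asboolP.
by move=> a x y /asboolP hx /asboolP hy; apply/asboolP; exact: SP.
Qed.

HB.instance Definition _ (M : lmodType R) (S : M -> Prop)
  (hS : submodule S) :=
  GRing.isSubmodClosed.Build R M (submodule_pred hS) (submodule_pred_closed hS).

Record submod (M : lmodType R) (S : M -> Prop) (hS : submodule S) : Type :=
  Submod { submod_val :> M; _ : submod_val \in submodule_pred hS }.

HB.instance Definition _ (M : lmodType R) (S : M -> Prop) (hS : submodule S) :=
  [isSub for @submod_val M S hS].
HB.instance Definition _ (M : lmodType R) (S : M -> Prop) (hS : submodule S) :=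
  [Choice of submod hS by <:].
HB.instance Definition _ (M : lmodType R) (S : M -> Prop) (hS : submodule S) :=
  [SubChoice_isSubLmodule of submod hS by <:].

Lemma submoduleE (M : lmodType R) (S : M -> Prop) : submodule S ->
  exists (B : lmodType R) (j : {linear B -> M}),
    injective j /\ forall x, S x <-> exists b, j b = x.
Proof.
move=> hS; exists (submod hS), (val : {linear submod hS -> M}).
split=> [|x]; first exact: val_inj.
split=> [Sx|[[y yS] <-]]; last exact/asboolP.
by exists (Submod (introT (asboolP _) Sx : x \in submodule_pred hS)).
Qed.

Lemma pi_quot_eq0 (V : zmodType) (I : zmodClosed V) (x : V) :
  \pi_(Quotient.quot I)%qT x = 0 <-> x \in I.
Proof.
have E : (x \in I) = (x == 0 %[mod Quotient.quot I])%qT.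
  by rewrite -Quotient.idealrBE subr0.
have Z : \pi_(Quotient.quot I)%qT 0 = 0 by rewrite raddf0.
by rewrite E -[X in _ = X <-> _]Z; split=> /eqP.
Qed.

(** Stated for abelian groups because the kernel combinations in the flatness criterion need not be
    stable under left scalars. *)
Lemma zmod_quotient (V : zmodType) (S : V -> Prop) :
  S 0 -> (forall x y, S x -> S y -> S (x - y)) ->
  exists (W : zmodType) (p : {additive V -> W}),
    (forall x, p x = 0 <-> S x) /\ forall w, exists x, p x = w.
Proof.
move=> S0 SB; pose P : {pred V} := fun x => `[< S x >].
have cl : zmod_closed P.
  by split=> [|x y /asboolP hx /asboolP hy]; apply/asboolP => //; exact: SB.
pose I : zmodClosed V :=
  HB.pack_for (zmodClosed V) (P : V -> bool) (GRing.isZmodClosed.Build V P cl).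
exists (Quotient.quot I), (\pi_(Quotient.quot I)%qT); split=> [x|w]; last first.
  by exists (repr w); apply: (@reprK _ (Quotient.quot I) w).
by split=> [/pi_quot_eq0/asboolP|Sx] //; apply/pi_quot_eq0/asboolP.
Qed.

Section Cokernel.
Variables (G : lmodType R) (S : G -> Prop) (hS : submodule S).

Definition quotmod : Type := Quotient.quot (submodule_pred hS).
HB.instance Definition _ := GRing.Zmodule.on quotmod.

Let p : {additive G -> quotmod} :=
  \pi_(Quotient.quot (submodule_pred hS))%qT.

Definition quotmod_scale (a : R) (w : quotmod) : quotmod :=
  p (a *: @repr _ (Quotient.quot (submodule_pred hS)) w).

Let pK w : p (@repr _ (Quotient.quot (submodule_pred hS)) w) = w.
Proof. exact: (@reprK _ (Quotient.quot (submodule_pred hS))). Qed.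

Let pE x : p x = 0 <-> S x.
Proof.
by split=> [/pi_quot_eq0/asboolP|Sx] //; apply/pi_quot_eq0/asboolP.
Qed.

Let scaleE a x : quotmod_scale a (p x) = p (a *: x).
Proof.
apply/eqP; rewrite -subr_eq0 -raddfB -scalerBr; apply/eqP/pE.
have [S0 SP] := hS; rewrite -[_ *: _]addr0; apply: SP => //.
by apply/pE; rewrite raddfB pK subrr.
Qed.

Fact quotmod_scaleA a b w : quotmod_scale a (quotmod_scale b w) = quotmod_scale (a * b) w.
Proof. by rewrite -(pK w) !scaleE scalerA. Qed.
Fact quotmod_scale1 : left_id 1 quotmod_scale.
Proof. by move=> w; rewrite -(pK w) scaleE scale1r. Qed.
Fact quotmod_scaleDr : right_distributive quotmod_scale +%R.
Proof.
by move=> a w z; rewrite -(pK w) -(pK z) -raddfD !scaleE scalerDr raddfD.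
Qed.
Fact quotmod_scaleDl w : {morph quotmod_scale^~ w : a b / a + b}.
Proof. by move=> a b; rewrite -(pK w) !scaleE scalerDl raddfD. Qed.
HB.instance Definition _ := GRing.Zmodule_isLmodule.Build R quotmod
  quotmod_scaleA quotmod_scale1 quotmod_scaleDr quotmod_scaleDl.

Lemma cokernel : exists (C : lmodType R) (v : {linear G -> C}),
    (forall x, v x = 0 <-> S x) /\ forall z, exists y, v y = z.
Proof.
have lin : linear (p : G -> quotmod).
  by move=> a x y; rewrite raddfD -scaleE.
exists quotmod, (linear_of lin); split=> // z.
by exists (@repr _ (Quotient.quot (submodule_pred hS)) z); apply: pK.
Qed.

End Cokernel.

End Submodules.

(** * Finite generation of submodules over a Noetherian ring *)

Section Noetherian.
Variable R : nzRingType.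

Fixpoint in_span (M : lmodType R) (s : seq M) (x : M) : Prop :=
  if s is a :: t then exists r : R, in_span t (x - r *: a) else x = 0.

Lemma in_span_submodule (M : lmodType R) (s : seq M) : submodule (in_span s).
Proof.
elim: s => [|a s [IH0 IHP]]; split=> //=.
- by move=> b x y -> ->; rewrite scaler0 addr0.
- by exists 0; rewrite scale0r subr0.
move=> b x y [r hr] [t ht]; exists (b * r + t).
rewrite scalerDl -scalerA opprD addrACA -scalerBr; exact: IHP.
Qed.

Lemma in_span_cat (M : lmodType R) (s t : seq M) (x y : M) :
  in_span s x -> in_span t y -> in_span (s ++ t) (x + y).
Proof.
move=> + ty; elim: s x => [|a s IH] x /=; first by move->; rewrite add0r.
by move=> [r /IH]; rewrite addrAC; exists r.
Qed.

Lemma in_span_sum (M : lmodType R) (s : seq M) (x : M) :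
  in_span s x -> exists c : 'I_(size s) -> R, x = \sum_i c i *: s`_i.
Proof.
elim: s x => [|a s IH] x /=; first by move->; exists (fun=> 0); rewrite big_ord0.
move=> [r /IH[c hc]].
exists (fun i => oapp c r (unlift ord0 i)).
rewrite big_ord_recl unlift_none /= -(subrK (r *: a) x) hc addrC; congr (_ + _).
by apply: eq_bigr => i _; rewrite liftK.
Qed.

Lemma mem_in_span (M : lmodType R) (s : seq M) (x : M) : x \in s -> in_span s x.
Proof.
elim: s => //= a s IH; rewrite inE => /predU1P[->|/IH xs].
  by exists 1; rewrite scale1r subrr; case: (in_span_submodule s).
by exists 0; rewrite scale0r subr0.
Qed.

Hypothesis hR : left_noetherian R.

(** Otherwise every finite list in [J] misses some element of [J]; adjoining missed elements one at
    a time gives an ascending chain of spans that never stabilises. *)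
Lemma noetherian_ideal (J : R^o -> Prop) : submodule J ->
  exists s : seq R^o, (forall y, y \in s -> J y) /\ forall x, J x -> in_span s x.
Proof.
move=> hJ; apply: contrapT => nfg.
have ext (s : {s : seq R^o | forall y, y \in s -> J y}) :
    exists x, J x /\ ~ in_span (sval s) x.
  case: s => s hs /=; apply: contrapT => nx; apply: nfg; exists s; split=> // x Jx.
  by apply: contrapT => nsx; apply: nx; exists x.
have [f hf] := choice ext.
have hcons (s : {s : seq R^o | forall y, y \in s -> J y}) y :
    y \in f s :: sval s -> J y.
  by rewrite inE => /predU1P[->|/(svalP s)//]; case: (hf s).
pose step s := exist (fun s : seq R^o => forall y, y \in s -> J y) _ (hcons s).
have hnil y : y \in ([::] : seq R^o) -> J y by [].
pose g k := iter k step (exist (fun s : seq R^o => forall y, y \in s -> J y) _ hnil).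
have [|k x /= gx|m hm] := hR (J := fun k => in_span (sval (g k))).
- by move=> k; apply: in_span_submodule.
- by exists 0; rewrite scale0r subr0.
have [_] := hf (g m); apply; apply/(hm m.+1 (leqnSn m)) => /=; exists 1.
by rewrite scale1r subrr; case: (in_span_submodule (sval (g m))).
Qed.

(** Induction on [s]: the possible coefficients at [a] of elements of [S] form a left ideal [J].
    Lifts to [S] of finitely many generators of [J], together with generators of the part of [S] in
    the span of the tail, generate [S]. *)
Lemma noetherian_span (M : lmodType R) (s : seq M) (S : M -> Prop) :
  submodule S -> (forall x, S x -> in_span s x) ->
  exists t : seq M, (forall y, y \in t -> S y) /\ forall x, S x -> in_span t x.
Proof.
elim: s S => [|a s IH] S [S0 SP] hS; first by exists [::].
have [H0 HP] := in_span_submodule s.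
pose J (r : R^o) := exists x, S x /\ in_span s (x - r *: a).
have hJ : submodule J.
  split; first by exists 0; rewrite scale0r subr0.
  move=> b r1 r2 [x [Sx hx]] [y [Sy hy]]; exists (b *: x + y); split; first exact: SP.
  rewrite scalerDl -scalerA opprD addrACA -scalerBr; exact: HP.
have [rs [rsJ Jrs]] := noetherian_ideal hJ.
have lift_gens (l : seq R^o) : (forall y, y \in l -> J y) ->
    exists xs : seq M, (forall y, y \in xs -> S y) /\
      forall r, in_span l r -> exists x, [/\ S x, in_span xs x & in_span s (x - r *: a)].
  elim: l => [|b l IHl] hJl.
    by exists [::]; split=> // r /= ->; exists 0; split; rewrite // scale0r subr0.
  have [y|xs [xsS hxs]] := IHl; first by move=> yl; apply: hJl; rewrite inE yl orbT.
  have [xb [Sxb hxb]] := hJl b (mem_head _ _).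
  exists (xb :: xs); split=> [y|r /= [t /hxs[x [Sx xsx hx]]]].
    by rewrite inE => /predU1P[->|/xsS].
  exists (t *: xb + x); split; first exact: SP.
    by exists t; rewrite addrAC subrr add0r.
  have -> : t *: xb + x - r *: a = t *: (xb - b *: a) + (x - (r - t *: b) *: a).
    by rewrite scalerBl -scalerA scalerBr opprB addrACA addKr.
  exact: HP.
have [xs [xsS hxs]] := lift_gens rs rsJ.
have [||t [tS ht]] := IH (fun x => S x /\ in_span s x).
- split=> [|b x y [Sx hx] [Sy hy]]; first by split.
  by split; [apply: SP | apply: HP].
- by move=> x [].
exists (xs ++ t); split=> [y|x Sx].
  by rewrite mem_cat => /orP[/xsS|/tS[]].
have /= [r hr] := hS x Sx.
have Jr : J r by exists x.
have [x1 [Sx1 xs1 hx1]] := hxs _ (Jrs _ Jr).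
rewrite -(subrK x1 x) addrC; apply: in_span_cat => //; apply: ht.
split; first by rewrite addrC -scaleN1r; apply: SP.
have -> : x - x1 = -1 *: (x1 - r *: a) + (x - r *: a).
  by rewrite scaleN1r opprB [RHS]addrC addrA subrK.
exact: HP.
Qed.

Lemma noetherian_fg (U V : lmodType R) (f : {linear U -> V}) :
  finitely_generated V -> injective f -> finitely_generated U.
Proof.
move=> [n [e he]] fI.
have [x _|t [tS ht]] := @noetherian_span V [seq e i | i <- enum 'I_n]
    (fun y => exists x, f x = y) (range_submodule f).
  have [c ->] := he x.
  have [H0 HP] := in_span_submodule [seq e i | i <- enum 'I_n].
  elim/big_ind: _ => // [y z hy hz|i _]; first by rewrite -[y]scale1r; apply: HP.
  rewrite -[_ *: _]addr0; apply: HP => //; apply: mem_in_span.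
  by rewrite map_f // mem_enum.
have /choice[g hg] : forall i : 'I_(size t), exists x, f x = t`_i.
  by move=> i; apply/tS/mem_nth.
exists (size t), g => x.
have [|c hc] := @in_span_sum _ t (f x); first by apply: ht; exists x.
exists c; apply: fI; rewrite hc linear_sum; apply: eq_bigr => i _.
by rewrite linearZ hg.
Qed.
End Noetherian.

(** * Tensor sums and the equational criterion for flatness *)

Section Flat.
Variables (R : nzRingType) (M : lmodType R).

Lemma tens_suml (N : lmodType R^c) (T : finType) (F : T -> N) (m : M) :
  tens (\sum_i F i) m = \sum_i tens (F i) m.
Proof.
apply: (big_morph (fun x => tens x m)) => [x y|]; first exact: tensDl.
by apply: (addrI (tens 0 m)); rewrite -tensDl !addr0.
Qed.

Lemma tens_sumr (N : lmodType R^c) (T : finType) (x : N) (F : T -> M) :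
  tens x (\sum_i F i) = \sum_i tens x (F i).
Proof.
apply: (big_morph (tens x)) => [y z|]; first exact: tensDr.
by apply: (addrI (tens x 0)); rewrite -tensDr !addr0.
Qed.

Lemma tensor_lift_sum (N : lmodType R^c) (V : zmodType) (b : N -> M -> V) (T : finType)
    (F : T -> tensor N M) : balanced b ->
  tensor_lift b (\sum_i F i) = \sum_i tensor_lift b (F i).
Proof.
move=> hb; have L0 : tensor_lift b 0 = 0.
  by rewrite -[0 in LHS]subr0 tensor_lift_additive // subrr.
apply: (big_morph (tensor_lift b)) => // x y.
have -> : x + y = x - (0 - y) by rewrite sub0r opprK.
by rewrite !tensor_lift_additive // L0 sub0r opprK.
Qed.

(** Membership of [y] in the image of $\ker B \otimes M \to M^n$, with a tensor given as a list of
    pairs. *)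
Definition kernel_combination (J : finType) n (B : J -> 'I_n -> R)
    (y : 'I_n -> M) : Prop :=
  exists s : seq ({ffun 'I_n -> R} * M)%type,
    (forall p, p \in s -> forall j, \sum_i B j i * p.1 i = 0) /\
    forall i, y i = \sum_(p <- s) p.1 i *: p.2.

(* The equational criterion: for the image [N] of [B : R^n -> R^J] in right
   modules, flatness makes [N (x) M -> R^J (x) M] injective, and the quotient
   of [M^n] by the combinations of [ker B] receives a balanced map from
   [N * M]. *)
Lemma flat_relation (J : finType) n (B : J -> 'I_n -> R) (y : 'I_n -> M) :
  flat M -> (forall j, \sum_i B j i *: y i = 0) -> kernel_combination B y.
Proof.
move=> hM hy.
pose P : lmodType R^c := {ffun 'I_n -> (R^c)^o}.
pose Q : lmodType R^c := {ffun J -> (R^c)^o}.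
pose beta (u : P) : Q := [ffun j => \sum_i ((B j i : R) * (u i : R))].
have beta_lin : linear beta.
  move=> a u v; apply/ffunP => j; rewrite !ffunE.
  rewrite -[X in _ = X + _]/((\sum_i ((B j i : R) * (u i : R))) * (a : R)) mulr_suml -big_split /=.
  by apply: eq_bigr => i _; rewrite !ffunE mulrDr mulrA.
pose K (w : {ffun 'I_n -> M}) := kernel_combination B w.
have K0 : K 0.
  by exists [::]; split=> // i; rewrite big_nil ffunE.
have KB w z : K w -> K z -> K (w - z).
  move=> [s [sB ws]] [t [tB zt]].
  exists (s ++ [seq (p.1, - p.2) | p <- t]); split=> [p|i].
    by rewrite mem_cat => /orP[/sB//|/mapP[q /tB qB ->]].
  rewrite big_cat big_map /= !ffunE ws zt; congr (_ + _).
  by rewrite -sumrN; apply: eq_bigr => p _; rewrite scalerN.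
have [V [p [pE _]]] := zmod_quotient K0 KB.
(* [g] is balanced and kills the kernel of [beta] in its first argument, so it descends to the image
   [N] of [beta]. *)
pose g (u : P) (m : M) := p [ffun k => (u k : R) *: m].
have gDl u v m : g (u + v) m = g u m + g v m.
  rewrite -raddfD; congr (p _); apply/ffunP => k.
  by rewrite !ffunE scalerDl.
have gDr u m m' : g u (m + m') = g u m + g u m'.
  rewrite -raddfD; congr (p _); apply/ffunP => k.
  by rewrite !ffunE scalerDr.
have gker u m : beta u = 0 -> g u m = 0.
  move=> /ffunP hu; apply/pE; exists [:: (u, m)]; split=> [q|i].
    by rewrite inE => /eqP-> j; have := hu j; rewrite !ffunE.
  by rewrite big_seq1 ffunE.
have gM u (r : R) m : g ((r : R^c) *: u) m = g u (r *: m).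
  by congr (p _); apply/ffunP => k; rewrite !ffunE scalerA.
have geq u v m : beta u = beta v -> g u m = g v m.
  move=> e; have -> : u = (u - v) + v by rewrite subrK.
  rewrite gDl gker ?add0r //.
  by rewrite -[beta]/(linear_of beta_lin : P -> Q) linearB /= e subrr.
have [N [j [jI jE]]] := submoduleE (range_submodule (linear_of beta_lin)).
(* The choice [c] of preimages need not be additive, but by [geq] the value of [b] does not depend
   on it. *)
have /choice[c hc] : forall v, exists u, beta u = j v.
  by move=> v; apply/jE; exists v.
pose b v m := g (c v) m.
have bb : balanced b.
  split=> [v v' m|v m m'|v r m]; rewrite /b ?gDr // -?gDl -?gM; apply: geq.
    rewrite hc linearD -!hc.
    by rewrite -[beta]/(linear_of beta_lin : P -> Q) linearD.
  rewrite hc linearZ -!hc.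
  by rewrite -[beta]/(linear_of beta_lin : P -> Q) linearZ.
pose delta i : P := [ffun k => (k == i)%:R].
have /choice[nu hnu] : forall i, exists v, j v = beta (delta i).
  by move=> i; apply/jE; exists (delta i).
pose e k : Q := [ffun l => (l == k)%:R].
have betaE i : beta (delta i) = \sum_k (B k i : R^c) *: e k.
  apply/ffunP => l; rewrite sum_ffunE !ffunE (bigD1 i) //= big1 ?addr0; last first.
    by move=> k /negPf ki; rewrite !ffunE ki mulr0.
  rewrite ffunE eqxx mulr1 (bigD1 l) //= big1 ?addr0; last first.
    by move=> k; rewrite eq_sym => /negPf lk; rewrite !ffunE lk scaler0.
  by rewrite !ffunE eqxx [RHS]mul1r.
(* Over [Q] this tensor becomes the sum over [k] of [e k] tensored with the [k]-th relation, hence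
   zero; flatness gives [t = 0]. *)
pose t := \sum_i tens (nu i) (y i) : tensor N M.
have t0 : t = 0.
  apply: (hM _ _ _ jI); have mb := tensor_map_balanced M j.
  transitivity (0 : tensor Q M); last first.
    by rewrite /tensor_map -[0 in RHS]subr0 tensor_lift_additive // subrr.
  rewrite /tensor_map /t tensor_lift_sum //.
  under eq_bigr => i _ do
    rewrite tensor_lift_tens // hnu betaE tens_suml.
  rewrite exchange_big big1 // => k _.
  under eq_bigr => i _ do rewrite tensM.
  by rewrite -tens_sumr hy; apply: (addrI (tens (e k) 0)); rewrite -tensDr !addr0.
(* On the other hand [b] sends [t] to the class of [y] in [V], so [y] is a kernel combination. *)
have : tensor_lift b t = 0.
  by rewrite t0 -[0 in LHS]subr0 tensor_lift_additive // subrr.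
rewrite /t tensor_lift_sum //.
under eq_bigr => i _ do
  rewrite tensor_lift_tens // /b (geq (c (nu i)) (delta i)) ?hc //.
rewrite -raddf_sum => /pE[s [sB ws]]; exists s; split=> // k.
rewrite -ws sum_ffunE (bigD1 k) //= big1 ?addr0; last first.
  by move=> i; rewrite eq_sym => /negPf ki; rewrite !ffunE ki scale0r.
by rewrite !ffunE eqxx scale1r.
Qed.
End Flat.

(** * Coordinates on finitely generated free modules *)

Section Coordinates.
Variables (R : nzRingType) (n : nat).

Definition unit_vector (i : 'I_n) : {ffun 'I_n -> R^o} :=
  [ffun k => (k == i)%:R].

Lemma unit_vector_sum (c : {ffun 'I_n -> R}) (d : {ffun 'I_n -> R^o}) :
  d = \sum_i c i *: unit_vector i <-> c = d.
Proof.
have E : \sum_i c i *: unit_vector i = c :> {ffun 'I_n -> R^o}.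
  apply/ffunP => k; rewrite sum_ffunE (bigD1 k) //= big1 ?addr0; last first.
    by move=> i; rewrite eq_sym => /negPf ki; rewrite !ffunE ki scaler0.
  by rewrite !ffunE eqxx [LHS]mulr1.
by rewrite E; split=> ->.
Qed.

Lemma ffun_fg_free : fg_free {ffun 'I_n -> R^o}.
Proof.
exists n, unit_vector => x; exists x; split=> [|c]; first exact/unit_vector_sum.
by move=> /unit_vector_sum.
Qed.

Lemma fg_free_fg (G : lmodType R) : fg_free G -> finitely_generated G.
Proof.
move=> [m [e he]]; exists m, e => x; have [c [-> _]] := he x.
by exists c.
Qed.

Lemma linear_ffunE (E : lmodType R) (h : {linear {ffun 'I_n -> R^o} -> E}) c :
  h c = \sum_i c i *: h (unit_vector i).
Proof.
rewrite [in LHS]((unit_vector_sum c c).2 erefl) linear_sum.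
by apply: eq_bigr => i _; rewrite linearZ.
Qed.

Lemma comb_linear (M : lmodType R) (y : 'I_n -> M) :
  linear (fun c : {ffun 'I_n -> R^o} => \sum_i (c i : R) *: y i).
Proof.
move=> a c d; rewrite scaler_sumr -big_split /=.
by apply: eq_bigr => i _; rewrite !ffunE scalerDl scalerA.
Qed.

End Coordinates.

(** Uniqueness of the coefficients is what makes each of them a linear functional. *)
Lemma fg_free_coordinates (R : nzRingType) (G : lmodType R) : fg_free G ->
  exists n (e : 'I_n -> G) (p : 'I_n -> {linear G -> R^o}),
    (forall x, x = \sum_i (p i x : R) *: e i) /\
    forall (c : 'I_n -> R) i, p i (\sum_k c k *: e k) = c i.
Proof.
move=> [n [e he]]; exists n, e.
have /choice[c hc] : forall x, exists c : {ffun 'I_n -> R}, x = \sum_i c i *: e i.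
  by move=> x; have [c [? _]] := he x; exists c.
have cU x (d : {ffun 'I_n -> R}) : x = \sum_i d i *: e i -> c x = d.
  move=> hd; have [b [_ bU]] := he x.
  by rewrite -(bU (c x)) // -(bU d).
have lin i : linear (fun x => c x i : R^o).
  move=> a x y; have -> : c (a *: x + y) = [ffun k => a * c x k + c y k].
    apply: cU; rewrite [in LHS](hc x) [in LHS](hc y) scaler_sumr -big_split /=.
    by apply: eq_bigr => k _; rewrite ffunE scalerDl scalerA.
  by rewrite ffunE.
exists (fun i => linear_of (lin i)); split=> [x|d i /=]; first exact: hc.
rewrite (cU _ [ffun k => d k]) ?ffunE //.
by apply: eq_bigr => k _; rewrite ffunE.
Qed.

(** * Pairing the bidual with relations over a module *)

Section Pairing.
Variables (R : nzRingType) (A : lmodType R).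
Hypothesis hA : finitely_generated A.

Lemma hom_sumE (U V : lmodType R) (T : Type) (s : seq T) (F : T -> Defs.hom U V) x :
  hom_fun (\sum_(i <- s) F i) x = \sum_(i <- s) hom_fun (F i) x.
Proof. exact: (big_morph (fun f : Defs.hom U V => hom_fun f x)). Qed.

Lemma pairing_linear (M : lmodType R) (l : seq (dual A * M)) :
  linear (fun x => \sum_(p <- l) (hom_fun p.1 x : R) *: p.2).
Proof.
move=> a x y; rewrite scaler_sumr -big_split /=.
by apply: eq_bigr => p _; rewrite linearP scalerDl scalerA.
Qed.

(* Each [phi] in [A^**] induces a map [A^* (x) M -> M]; the condition says that
   it vanishes on the kernel of the canonical map [A^* (x) M -> Hom(A, M)]. *)
Definition bidual_pairing (M : lmodType R) : Prop :=
  forall l : seq (dual A * M),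
    (forall x, \sum_(p <- l) (hom_fun p.1 x : R) *: p.2 = 0) ->
    forall phi : rdual (dual A),
      \sum_(p <- l) (hom_fun phi p.1 : R) *: p.2 = 0.

(** Evaluated at generators [a j] of [A], the relation becomes a linear system with coefficients
    [f i (a j)]. Flatness writes [y] in terms of solutions $c$ over [R]; each has $\sum f_i c_i = 0$
    in $A^*$, so right linearity of [phi] gives $\sum \phi(f_i) c_i = 0$. *)
Lemma flat_bidual_pairing (M : lmodType R) : flat M -> bidual_pairing M.
Proof.
move=> hM l hl phi; have [k [a ha]] := hA.
have E (F : dual A * M -> M) :
    \sum_(p <- l) F p = \sum_i F (tnth (in_tuple l) i) by rewrite big_tnth.
pose f i := (tnth (in_tuple l) i).1; pose y i := (tnth (in_tuple l) i).2.
have [j|s [sB ys]] := @flat_relation R M _ _ (fun (j : 'I_k) i => hom_fun (f i) (a j) : R) y hM.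
  by have := hl (a j); rewrite E.
rewrite E; under eq_bigr => i _ do rewrite -/(f i) -/(y i) ys scaler_sumr.
rewrite exchange_big big_seq big1 //= => p ps.
have f0 : \sum_i (p.1 i : R^c) *: f i = 0 :> dual A.
  apply: homP => x; have [c ->] := ha x.
  rewrite linear_sum big1 // => j _; rewrite linearZ hom_sumE.
  have -> : \sum_i hom_fun ((p.1 i : R^c) *: f i) (a j) = 0 by exact: sB p ps j.
  exact: scaler0.
have phi0 : \sum_i (hom_fun phi (f i) : R) * p.1 i = 0.
  transitivity (hom_fun phi (\sum_i (p.1 i : R^c) *: f i)).
    rewrite linear_sum; apply: eq_bigr => i _.
    exact: esym (linearZZ (hom_fun phi) (p.1 i : R^c) (f i)).
  by rewrite f0 raddf0.
under eq_bigr => i _ do rewrite scalerA.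
by rewrite -scaler_suml [X in X *: _]phi0 scale0r.
Qed.

(* Lift the coefficients of a relation to the flat cover [F0] of [M]. The
   resulting defect lies in [F1] and is annihilated by the finitely many
   relations between generators of [A], so flatness of [F1] writes it with
   elements of [A^*]. This corrects the lift to a relation over [F0]. *)
Lemma flat_dim_bidual_pairing (M : lmodType R) : left_noetherian R ->
  flat_dim_le1 M -> bidual_pairing M.
Proof.
move=> hR [F1 [F0 [u [v [hF1 hF0 [uI uv vS]]]]]] l hl phi.
have [k [a ha]] := hA; have [t vt] := choice vS.
pose l0 := [seq (p.1, t p.2) | p <- l].
have /choice[z hz] j : exists z, u z = \sum_(p <- l0) (hom_fun p.1 (a j) : R) *: p.2.
  apply/uv; rewrite linear_sum big_map -[RHS](hl (a j)).
  by apply: eq_bigr => p _; rewrite linearZ /= vt.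
(* The kernel [W] of [q] consists of the relations among the generators [a j]; the Noetherian
   hypothesis gives finitely many generators [om]. *)
pose q := linear_of (comb_linear a); pose P := linear_of (pairing_linear l0).
have [W [jW [jWI jWE]]] := submoduleE (ker_submodule q).
have [m [om hom]] := noetherian_fg hR (fg_free_fg (@ffun_fg_free R k)) jWI.
have qS x : exists c, q c = x.
  by have [c ->] := ha x; exists [ffun i => c i]; apply: eq_bigr => i _; rewrite ffunE.
have [i|s [sB zs]] := @flat_relation R F1 _ _ (fun i j => jW (om i) j : R) z hF1.
  apply: uI; rewrite raddf0 linear_sum.
  have q0 : q (jW (om i)) = 0 by apply/jWE; exists (om i).
  transitivity (P (q (jW (om i)))); last by rewrite q0 raddf0.
  rewrite -[q _]/(\sum_j (jW (om i) j : R) *: a j) linear_sum.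
  by apply: eq_bigr => j _; rewrite linearZ hz [RHS]linearZ.
(* A vector killed by the relations [om] is the list of values at the [a j] of a functional on [A];
   outside [s] the value [0] is a dummy. *)
have /choice[g hg] (p : {ffun 'I_k -> R} * F1) :
    exists g : dual A, p \in s -> forall j, hom_fun g (a j) = p.1 j.
  have [ps|] := boolP (p \in s); last by exists 0.
  pose h := linear_of (comb_linear (fun j => p.1 j : R^o)).
  have [x||g hg] := @linear_factor _ _ _ _ _ q (idfun : {linear A -> A}) h.
  - exact: qS.
  - move=> c /jWE[w <-]; have [d ->] := hom w.
    rewrite !linear_sum big1 // => i _; rewrite !linearZ.
    have -> : h (jW (om i)) = 0 by exact: sB p ps i.
    exact: scaler0.
  exists g => _ j; rewrite (hg (unit_vector R j)) /=.
    rewrite (bigD1 j) //= big1 ?addr0; last first.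
      by move=> i /negPf ij; rewrite !ffunE ij scale0r.
    by rewrite ffunE eqxx scale1r.
  rewrite (bigD1 j) //= big1 ?addr0; last first.
    by move=> i /negPf ij; rewrite !ffunE ij scale0r.
  by rewrite ffunE eqxx scale1r.
(* The added pairs cancel the defect [u (z j)] at each [a j]; applying [v] later removes them, since
   [v] vanishes on the range of [u]. *)
pose l1 := l0 ++ [seq (g p, - u p.2) | p <- s].
have l1_null x : \sum_(p <- l1) (hom_fun p.1 x : R) *: p.2 = 0.
  pose P1 := linear_of (pairing_linear l1); rewrite -[LHS]/(P1 x).
  have [c ->] := ha x; rewrite linear_sum big1 // => j _; rewrite linearZ.
  have -> : P1 (a j) = 0; last exact: scaler0.
  rewrite -[LHS]/(\sum_(p <- l1) (hom_fun p.1 (a j) : R) *: p.2).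
  rewrite big_cat /= -hz zs linear_sum big_map -big_split /= big_seq big1 //.
  by move=> p ps; rewrite hg // linearZ scalerN subrr.
have := congr1 v (flat_bidual_pairing hF0 l1_null phi).
rewrite big_cat /l0 /= !big_map linearD !linear_sum linear0 /= [X in _ + X]big1 ?addr0.
  by move=> e; rewrite -[RHS]e; apply: eq_bigr => p _; rewrite linearZ /= vt.
move=> p _; rewrite linearZ raddfN /= (_ : v (u p.2) = 0) ?oppr0 ?scaler0 //.
by apply/uv; exists p.2.
Qed.

(* For [f] in [A^*], extending [eta \o f] to [G] yields the relation
   [f (x) eta 1 = sum (p_i u) (x) g e_i] in [Hom(A, E)]; apply [phi] to it. *)
Lemma restriction_bidual_eq0 (G E : lmodType R) (u : {linear A -> G})
    n (e : 'I_n -> G) (p : 'I_n -> {linear G -> R^o}) (eta : {linear R^o -> E}) :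
  injective u -> (forall x, x = \sum_i (p i x : R) *: e i) ->
  injective_module E -> flat E -> injective eta ->
  forall phi : rdual (dual A),
    (forall i, hom_fun phi (p i \o u : {linear A -> R^o}) = 0) -> phi = 0.
Proof.
move=> uI pe hE fE etaI phi phi0; apply: homP => f.
have [g hg] := hE _ _ u (eta \o hom_fun f : {linear A -> E}) uI.
pose l : seq (dual A * E) := (f, eta (1 : R)) ::
  [seq ((p i \o u : {linear A -> R^o}) : dual A, - g (e i)) | i <- enum 'I_n].
have l_null x : \sum_(q <- l) (hom_fun q.1 x : R) *: q.2 = 0.
  rewrite big_cons big_map big_enum /= -linearZ [_ *: 1]mulr1.
  rewrite -[eta _]hg [in X in X + _](pe (u x)) linear_sum -big_split big1 // => i _.
  by rewrite linearZ scalerN; exact: subrr.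
have := flat_bidual_pairing fE l_null phi.
rewrite big_cons big_map big_enum /= [X in _ + X]big1 ?addr0 => [|i _]; last first.
  by rewrite phi0 scale0r.
by rewrite -linearZ [_ *: 1]mulr1 => h; apply: etaI; rewrite raddf0.
Qed.

(** Evaluation at the generators of [A] embeds $A^*$ in a finite free right module. *)
Lemma dual_fg : right_noetherian R -> finitely_generated (dual A : lmodType R^c).
Proof.
move=> hR; have [k [a ha]] := hA.
have lin : linear (fun f : dual A => [ffun j => hom_fun f (a j)] : {ffun 'I_k -> (R^c)^o}).
  by move=> r f g; apply/ffunP => j; rewrite !ffunE.
apply: (noetherian_fg hR (fg_free_fg (@ffun_fg_free R^c k)) (f := linear_of lin)).
move=> f g /ffunP h; apply: homP => x; have [c ->] := ha x.
by rewrite !linear_sum; apply: eq_bigr => j _; rewrite !linearZ; have := h j; rewrite !ffunE => ->.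
Qed.

(** The embedding of $A^{**}$ in a free module is evaluation at generators [f i] of $A^*$, and the
    [y i] are the values on unit vectors of an extension of [h] along it. *)
Lemma bidual_hom_eq0 (E : lmodType R) (h : {linear rdual (dual A) -> E}) :
  right_noetherian R -> injective_module E -> bidual_pairing E ->
  (forall x : A, h (sigma x) = 0) -> forall phi, h phi = 0.
Proof.
move=> hR hE pE h0; have [n [f hf]] := dual_fg hR.
have lin : linear (fun phi : rdual (dual A) =>
    [ffun i => hom_fun phi (f i)] : {ffun 'I_n -> R^o}).
  by move=> r phi psi; apply/ffunP => i; rewrite !ffunE.
have jI : injective (linear_of lin).
  move=> phi psi /ffunP e; apply: homP => g; have [c ->] := hf g.
  by rewrite !linear_sum; apply: eq_bigr => i _; rewrite !linearZ; have := e i; rewrite !ffunE => ->.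
have [g hg] := hE _ _ _ h jI.
pose y i := g (unit_vector R i).
have hE' phi : h phi = \sum_i (hom_fun phi (f i) : R) *: y i.
  by rewrite -hg linear_ffunE; apply: eq_bigr => i _; rewrite ffunE.
move=> phi; have := pE [seq (f i, y i) | i <- enum 'I_n].
move=> /(_ _ phi); rewrite big_map big_enum /= hE'; apply=> x.
by rewrite big_map big_enum /= -[RHS](h0 x) hE'.
Qed.
End Pairing.

(** * Existence of a member of [E_class A], and the two implications for a given one *)

Section Equivalence.
Variables (R : nzRingType) (A : lmodType R).
Hypothesis hA : finitely_generated A.

(* The generators of [A^*] embed [A] in a free module; the extra zero coordinate
   keeps the cokernel non-zero. *)
Lemma E_class_exists : right_noetherian R -> torsionless A ->
  exists C : lmodType R, E_class A C.
Proof.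
move=> hR htl; have [n [f hf]] := dual_fg hA hR.
pose F (i : 'I_n.+1) : dual A := oapp f 0 (unlift ord0 i).
have lin : linear (fun x => [ffun i => hom_fun (F i) x] : {ffun 'I_n.+1 -> R^o}).
  by move=> a x y; apply/ffunP => i; rewrite !ffunE linearP.
pose u := linear_of lin.
have uI : injective u.
  move=> x y /ffunP e; apply: htl; apply: homP => g /=.
  have [c ->] := hf g; rewrite /eval_fun !hom_sumE; apply: eq_bigr => i _.
  have := e (lift ord0 i); rewrite !ffunE /F liftK /= => fxy.
  by rewrite -[LHS]/(hom_fun (f i) x * c i) fxy.
have [C [v [vE vS]]] := cokernel (range_submodule u).
have [m [e he]] := fg_free_fg (@ffun_fg_free R n.+1).
exists C; split.
- exists (v (unit_vector R ord0)); apply/eqP => /vE[x /ffunP/(_ ord0)].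
  rewrite !ffunE /F unlift_none /= => /esym/eqP.
  exact/negP/oner_neq0.
- exists m, (fun i => v (e i)) => z; have [y <-] := vS z.
  have [c {1}->] := he y; exists c; rewrite linear_sum.
  by apply: eq_bigr => i _; rewrite linearZ.
by exists {ffun 'I_n.+1 -> R^o}, u, v; split; [exact: ffun_fg_free|split].
Qed.

Variables (I : nat -> lmodType R) (eta : {linear R^o -> I 0%N})
    (d : forall n : nat, {linear I n -> I n.+1}).
Hypothesis hI : minimal_injective_resolution eta d.

Lemma reflexive_no_pseudo_null (C : lmodType R) :
  reflexive_module A -> E_class A C -> no_pseudo_null_submodule I C.
Proof.
move=> [sigma_inv _ sigmaK] [_ _ [G [u [v [hG [uI uv vS]]]]]] M i iI [_ hM] [m /eqP]; apply.
have [etaI [eta_d _] injI _] := hI.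
have M0 (k : {linear M -> I 0%N}) x : k x = 0.
  have lin : linear (fun x => (k x, 0) : (I 0%N * I 1%N)%type).
    by move=> a y z; rewrite linearP; congr pair; rewrite /= scaler0 addr0.
  by have /(congr1 (fun f => (hom_fun f x).1)) := hM (linear_of lin).
have M1 (k : {linear M -> I 1%N}) x : k x = 0.
  have lin : linear (fun x => (0, k x) : (I 0%N * I 1%N)%type).
    by move=> a y z; rewrite linearP; congr pair; rewrite /= scaler0 addr0.
  by have /(congr1 (fun f => (hom_fun f x).2)) := hM (linear_of lin).
have [B [j [jI jE]]] := submoduleE (preim_submodule v (range_submodule i)).
have [uB uBE] : exists uB : {linear A -> B}, forall x, j (uB x) = u x.
  apply: linear_lift => // x; apply/jE; exists 0; rewrite raddf0.
  by apply/esym/uv; exists x.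
pose q : {linear B -> C} := v \o j.
have qS x : exists b, q b = i x.
  have [y yx] := vS (i x); have [|b bE] := (jE y).1; first by exists x.
  by exists b; rewrite /= bE.
have qi b : exists x, q b = i x.
  by have [|x ix] := (jE (j b)).2; [exists b | exists x; rewrite ix].
have q0 b : q b = 0 -> exists x, b = uB x.
  by move=> /uv[x ux]; exists x; apply: jI; rewrite uBE.
(* Extend [eta \o f] to [h] on [B]. As [d 0] after [h] vanishes on [A], it factors through [M],
   hence is zero, and [h] lands in the range of [eta]. *)
have extend (f : dual A) : exists F : dual B, forall x, hom_fun F (uB x) = hom_fun f x.
  have uBI : injective uB by move=> x y e; apply: uI; rewrite -!uBE e.
  have [h hh] := injI 0%N _ _ uB (eta \o hom_fun f : {linear A -> I 0%N}) uBI.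
  have [b /q0[x ->]|k kE] := linear_factor (h := d 0%N \o h : {linear B -> I 1%N}) qS.
    by rewrite /= hh; apply/eta_d; exists (hom_fun f x).
  have [b|F FE] := linear_lift (h := h) etaI.
    by apply/eta_d; have [x /kE /= <-] := qi b; apply: M1.
  by exists F => x; apply: etaI; rewrite FE hh.
(* A functional on [B] that is zero on [A] induces a map from [M] to [I 0], which is zero. *)
have unique (F : dual B) : (forall x, hom_fun F (uB x) = 0) -> F = 0.
  move=> F0; apply: homP => b; apply: etaI; rewrite raddf0.
  have [b' /q0[x ->]|k kE] :=
      linear_factor (h := eta \o hom_fun F : {linear B -> I 0%N}) qS.
    by rewrite /= F0 raddf0.
  by have [x /kE /= <-] := qi b; apply: M0.
have [Phi PhiE] := choice extend.
have Phi_eq f F : (forall x, hom_fun F (uB x) = hom_fun f x) -> Phi f = F.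
  move=> e; apply/eqP; rewrite -subr_eq0; apply/eqP/unique => x.
  by rewrite -[LHS]/(hom_fun (Phi f) (uB x) - hom_fun F (uB x)) PhiE e subrr.
have [b qb] := qS m.
(* Uniqueness makes [Phi] compatible with sums and scalars, so evaluating extensions at [b] is an
   element of $A^{**}$. *)
have lin : linear (fun f : dual A => hom_fun (Phi f) b : (R^c)^o).
  move=> r f g; rewrite (Phi_eq _ (r *: Phi f + Phi g)) // => x.
  rewrite -[LHS]/(hom_fun (Phi f) (uB x) * r + hom_fun (Phi g) (uB x)).
  by rewrite !PhiE.
pose phi : rdual (dual A) := linear_of lin.
have [n [e [p [pE _]]]] := fg_free_coordinates hG.
(* [p k \o j] is the extension of [p k \o u], so both points have [k]-th coordinate
   [phi (p k \o u)]. *)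
have jb : j b = u (sigma_inv phi).
  rewrite (pE (j b)) (pE (u _)); apply: eq_bigr => k _; congr (_ *: _).
  pose F : dual B := (p k \o j : {linear B -> R^o}).
  pose f : dual A := (p k \o u : {linear A -> R^o}).
  rewrite -[LHS]/(hom_fun F b) -(Phi_eq f F) => [|x]; last by rewrite /= uBE.
  rewrite -[LHS]/(hom_fun phi f) -[in LHS](sigmaK phi). by [].
apply: iI; rewrite raddf0 -qb; apply/uv; by exists (sigma_inv phi).
Qed.

Lemma no_pseudo_null_reflexive (C : lmodType R) :
  left_noetherian R -> right_noetherian R -> two_gorenstein I ->
  E_class A C -> no_pseudo_null_submodule I C -> reflexive_module A.
Proof.
move=> hl hr [flat0 fd1] [_ fgC [G [u [v [hG [uI uv vS]]]]]] hC.
have [etaI _ injI _] := hI.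
have [n [e [p [pE pc]]]] := fg_free_coordinates hG.
pose f i : dual A := (p i \o u : {linear A -> R^o}).
(* This is $u^{**}$ followed by the identification of $G^{**}$ with [G], written in coordinates. *)
have lin : linear (fun phi : rdual (dual A) => \sum_i (hom_fun phi (f i) : R) *: e i).
  move=> a phi psi; rewrite scaler_sumr -big_split /=; apply: eq_bigr => i _.
  by rewrite scalerA -scalerDl.
pose r := linear_of lin.
have rI : injective r.
  move=> phi psi rE; apply/eqP; rewrite -subr_eq0; apply/eqP.
  apply: (restriction_bidual_eq0 hA uI pE (injI 0%N) flat0 etaI) => i.
  rewrite -[LHS]/(hom_fun phi (f i) - hom_fun psi (f i)).
  by rewrite -(pc (fun k => hom_fun phi (f k))) -(pc (fun k => hom_fun psi (f k))) [X in p i X]rE subrr.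
have r_sigma x : r (sigma x) = u x by rewrite [RHS]pE.
pose w : {linear rdual (dual A) -> C} := v \o r.
(* Since [w] vanishes exactly on the range of [sigma], [M] is a copy of the quotient of $A^{**}$ by
   [A]. *)
have [M [j [jI jE]]] := submoduleE (range_submodule w).
have [w' w'E] : exists w' : {linear rdual (dual A) -> M}, forall phi, j (w' phi) = w phi.
  by apply: linear_lift => // phi; apply/jE; exists phi.
have w'S m : exists phi, m = w' phi.
  have [|phi hphi] := (jE (j m)).2; first by exists m.
  by exists phi; apply: jI; rewrite w'E.
have w'_sigma x : w' (sigma x) = 0.
  by apply: jI; rewrite w'E raddf0 -[LHS]/(v (r (sigma x))) r_sigma; apply/uv; exists x.
have hM : pseudo_null I M.
  split=> [|h]; first exact: @noetherian_fg R hl M C j fgC jI.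
  apply: homP => m; have [phi ->] := w'S m.
  have lin1 : linear (fun psi => (hom_fun h (w' psi)).1) by move=> a x y; rewrite !linearP.
  have lin2 : linear (fun psi => (hom_fun h (w' psi)).2) by move=> a x y; rewrite !linearP.
  have h1 := bidual_hom_eq0 hA (h := linear_of lin1) hr (injI 0%N) (flat_bidual_pairing hA flat0).
  have h2 := bidual_hom_eq0 hA (h := linear_of lin2) hr (injI 1%N) (flat_dim_bidual_pairing hA hl fd1).
  rewrite [LHS]surjective_pairing; congr pair; [apply: h1|apply: h2] => x /=;
  by rewrite w'_sigma raddf0.
(* [M] must be zero, so [w phi = 0] and [r phi] comes from some [x] in [A]; injectivity of [r] gives
   [sigma x = phi]. *)
have wsig (phi : rdual (dual A)) : exists x, sigma x = phi.
  have /uv[x ux] : w phi = 0.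
    rewrite -w'E; apply: contrapT => nz; apply: (hC M j jI hM); exists (w' phi).
    by apply/eqP => w0; apply: nz; rewrite w0 raddf0.
  by exists x; apply: rI; rewrite r_sigma.
have [s sK] := choice wsig.
exists s => // x; apply: uI; rewrite -!r_sigma sK //.
Qed.

End Equivalence.

Theorem theorem4p3 (R : nzRingType)
    (I : nat -> lmodType R) (eta : {linear R^o -> I 0%N})
    (d : forall n : nat, {linear I n -> I n.+1})
    (hI : minimal_injective_resolution eta d)
    (hl : left_noetherian R) (hr : right_noetherian R)
    (hG : two_gorenstein I)
    (A : lmodType R) (hfg : finitely_generated A) (htl : torsionless A) :
  (reflexive_module A <->
     (forall C : lmodType R, E_class A C -> no_pseudo_null_submodule I C)) /\
  (reflexive_module A <->
     (exists C : lmodType R, E_class A C /\ no_pseudo_null_submodule I C)).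
Proof.
(* [E_class A] must have a member: the universal statement would otherwise be vacuous, and the
   existential one would lack a witness. *)
have [C0 hC0] := E_class_exists hfg hr htl.
split; split=> [hA|].
- by move=> C hC; exact: (reflexive_no_pseudo_null hI hA hC).
- by move=> /(_ _ hC0); exact: (no_pseudo_null_reflexive hfg hI hl hr hG hC0).
- by exists C0; split=> //; exact: (reflexive_no_pseudo_null hI hA hC0).
- by move=> [C [hC hn]]; exact: (no_pseudo_null_reflexive hfg hI hl hr hG hC hn).
Qed.
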